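(* Let $k$ be a field of characteristic $0$, let $A_1,\dots,A_g\in M_d(k)$ and $\widetilde A_1,\dots,\widetilde A_g\in M_{e}(k)$, and consider the monic linear pencils $L=I_d-\sum_{i=1}^g A_ix_i$ and $\widetilde L=I_{e}-\sum_{i=1}^g\widetilde A_ix_i$. Let $\mathcal A\subseteq M_d(k)$ and $\widetilde{\mathcal A}\subseteq M_{e}(k)$ be the (possibly non-unital) $k$-algebras generated by $A_1,\dots,A_g$ and by $\widetilde A_1,\dots,\widetilde A_g$, respectively. (1) $\mathscr Z(L)\subseteq\mathscr Z(\widetilde L)$ if and only if there exists a homomorphism of $k$-algebras $\widetilde{\mathcal A}/\operatorname{rad}\widetilde{\mathcal A}\to\mathcal A/\operatorname{rad}\mathcal A$ induced by $\widetilde A_i\mapsto A_i$ (i.e. mapping the class of $\widetilde A_i$ to the class of $A_i$ for every $1\le i\le g$). (2) If moreover $L$ and $\widetilde L$ are minimal and $\mathcal A$ and $\widetilde{\mathcal A}$ are semisimple, then $\mathscr Z(L)=\mathscr Z(\widetilde L)$ if and only if there exists an invertible matrix $P$ over $k$ such that $\widetilde A_i=PA_iP^{-1}$ for all $1\le i\le g$.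
   Context: For a monic linear pencil $L=I_d-\sum_i A_ix_i$ of size $d$ in freely noncommuting variables $x_1,\dots,x_g$ and $X=(X_1,\dots,X_g)\in M_n(k)^g$, put $L(X)=I_d\otimes I_n-\sum_i A_i\otimes X_i\in M_{nd}(k)$ (Kronecker product). The free locus of $L$ is $\mathscr Z(L)=\bigcup_{n\in\mathbb N}\mathscr Z_n(L)$, where $\mathscr Z_n(L)=\{X\in M_n(k)^g:\det L(X)=0\}$. A monic pencil $L$ is minimal if it has the smallest size among all monic pencils (in the same variables, over $k$) whose free locus equals $\mathscr Z(L)$. Algebras generated by matrices are not required to contain the identity matrix (they are spanned by nonempty products of generators). For a (possibly non-unital) finite-dimensional $k$-algebra $\mathcal R$, $\operatorname{rad}\mathcal R$ denotes its largest nilpotent ideal; the quotient $\mathcal R/\operatorname{rad}\mathcal R$ may be $0$. *)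

(* Defs.v *)
From HB Require Import structures.
From mathcomp Require Import all_boot all_order all_algebra.
From mathcomp Require Import mxtens.
From mathcomp Require Import boolp classical_sets.

Set Implicit Arguments.
Unset Strict Implicit.
Unset Printing Implicit Defensive.

Import GRing.Theory.
Local Open Scope ring_scope.
Local Open Scope classical_set_scope.
Local Open Scope quotient_scope.

(* Associative, possibly non-unital k-algebras. MathComp's own algebra
   structures all carry a unit, so they cannot be used here. *)
HB.mixin Record isNonUnitalAlg (k : fieldType) V of GRing.Lmodule k V := {
  nmul : V -> V -> V;
  nmulA : associative nmul;
  nmul_linearl : forall y : V, linear (nmul^~ y);
  nmul_linearr : forall x : V, linear (nmul x)
}.

#[short(type="nuAlgType")]
HB.structure Definition NonUnitalAlg (k : fieldType) :=
  {V of GRing.Lmodule k V & isNonUnitalAlg k V}.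

#[short(type="finNUAlgType")]
HB.structure Definition FinNonUnitalAlg (k : fieldType) :=
  {V of Vector k V & isNonUnitalAlg k V}.

Local Notation "x ** y" := (nmul x y) (at level 40, left associativity).

Definition is_alg_hom (k : fieldType) (V W : nuAlgType k) (f : V -> W) : Prop :=
  linear f /\ {morph f : x y / x ** y}.

Section NonUnitalTheory.
Variables (k : fieldType) (V : nuAlgType k).
Implicit Types x y z : V.

Lemma nmulDl x y z : (x + y) ** z = x ** z + y ** z.
Proof. by have := nmul_linearl z 1 x y; rewrite !scale1r. Qed.

Lemma nmulDr x y z : z ** (x + y) = z ** x + z ** y.
Proof. by have := nmul_linearr z 1 x y; rewrite !scale1r. Qed.

Lemma nmulNl x z : (- x) ** z = - (x ** z).
Proof.
have /= := nmul_linearl z (-1) x x; rewrite !scaleN1r !addNr => z0.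
by have := nmul_linearl z (-1) x 0; rewrite !scaleN1r addr0 z0 addr0.
Qed.

Lemma nmulNr x z : z ** (- x) = - (z ** x).
Proof.
have /= := nmul_linearr z (-1) x x; rewrite !scaleN1r !addNr => z0.
by have := nmul_linearr z (-1) x 0; rewrite !scaleN1r addr0 z0 addr0.
Qed.

Lemma nmulBl x y z : (x - y) ** z = x ** z - y ** z.
Proof. by rewrite nmulDl nmulNl. Qed.

Lemma nmulBr x y z : z ** (x - y) = z ** x - z ** y.
Proof. by rewrite nmulDr nmulNr. Qed.

Lemma nmul0l x : 0 ** x = 0.
Proof. by rewrite -{1}(subrr x) nmulBl subrr. Qed.

Lemma nmul0r x : x ** 0 = 0.
Proof. by rewrite -{1}(subrr x) nmulBr subrr. Qed.

Lemma foldl_nmul x y (s : seq V) :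
  foldl nmul (x ** y) s = x ** foldl nmul y s.
Proof. by elim: s y => //= z s IHs y; rewrite -nmulA IHs. Qed.

End NonUnitalTheory.

Section Radical.
Variables (k : fieldType) (V : finNUAlgType k).
Implicit Types I J : {vspace V}.

Definition is_ideal J : Prop :=
  forall x y : V, y \in J -> x ** y \in J /\ y ** x \in J.

(* The products x ** s_1 ** ... ** s_n have n + 1 >= 1 factors. *)
Definition is_nilpotent J : Prop :=
  exists n, forall (x : V) (s : seq V), size s = n ->
    {subset x :: s <= J} -> foldl nmul x s = 0.

Definition is_nilpotent_ideal J : Prop := is_ideal J /\ is_nilpotent J.

Definition is_radical J : Prop :=
  is_nilpotent_ideal J /\
  forall I, is_nilpotent_ideal I -> (I <= J)%VS.

Lemma is_nilpotent_ideal0 : is_nilpotent_ideal 0%VS.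
Proof.
split=> [x y /[!memv0] /eqP ->|].
  by rewrite nmul0l nmul0r eqxx.
exists 0%N => x s /size0nil -> /(_ x) /=.
by rewrite mem_head memv0 => /(_ isT) /eqP.
Qed.

Lemma is_nilpotent_idealD I J :
  is_nilpotent_ideal I -> is_nilpotent_ideal J -> is_nilpotent_ideal (I + J)%VS.
Proof.
move=> [idI [n nilI]] [idJ [m nilJ]]; split=> [x _ /memv_addP[u uI [v vJ ->]]|].
  have [xuI uxI] := idI x u uI; have [xvJ vxJ] := idJ x v vJ.
  by rewrite nmulDl nmulDr !memv_add.
have modJ (x : V) s : {subset x :: s <= (I + J)%VS} ->
    exists u t, [/\ size t = size s, {subset u :: t <= I}
                  & foldl nmul x s - foldl nmul u t \in J].
  elim/last_ind: s => [|s z IHs] sIJ.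
    have /memv_addP[u uI [v vJ ->]] := sIJ x (mem_head _ _).
    exists u, [::]; split=> //= [y|]; first by rewrite inE => /eqP ->.
    by rewrite addrAC subrr add0r.
  have [y ys|u [t [szt tI dJ]]] := IHs.
    by apply: sIJ; rewrite -rcons_cons mem_rcons inE ys orbT.
  have /memv_addP[p pI [q qJ def_z]] : z \in (I + J)%VS.
    by apply: sIJ; rewrite -rcons_cons mem_rcons mem_head.
  exists u, (rcons t p); split; first by rewrite !size_rcons szt.
    by move=> y; rewrite -rcons_cons mem_rcons inE => /predU1P[->|/tI].
  rewrite !foldl_rcons def_z nmulDr addrAC -nmulBl addrC.
  by rewrite memvD //; [case: (idJ (foldl nmul x s) q qJ)|case: (idJ p _ dJ)].
have prodJ (x : V) s : size s = n -> {subset x :: s <= (I + J)%VS} ->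
    foldl nmul x s \in J.
  move=> szs /modJ[u [t [szt tI]]].
  by rewrite (nilI u t) ?subr0 // szt.
have grp r (x : V) s : size s = (r * n.+1)%N -> {subset s <= (I + J)%VS} ->
    exists t, [/\ size t = r, {subset t <= J}
                & foldl nmul x s = foldl nmul x t].
  elim: r x s => [|r IHr] x s szs sIJ.
    by exists [::]; split=> //; rewrite (size0nil szs).
  case: s => [//|y s] in szs sIJ *.
  have szs' : size s = (n + r * n.+1)%N by move: szs; rewrite mulSn addSn => -[].
  have szn : size (take n s) = n by rewrite size_takel // szs' leq_addr.
  have yJ : foldl nmul y (take n s) \in J.
    apply: prodJ => // z; rewrite inE => /predU1P[->|/mem_take zs].
      by rewrite sIJ ?mem_head.
    by rewrite sIJ // inE zs orbT.
  have [||t [szt tJ eqt]] := IHr (x ** foldl nmul y (take n s)) (drop n s).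
  - by rewrite size_drop szs' addKn.
  - by move=> z /mem_drop zs; rewrite sIJ // inE zs orbT.
  exists (foldl nmul y (take n s) :: t); split; first by rewrite /= szt.
    by move=> z; rewrite inE => /predU1P[->|/tJ].
  by rewrite /= -eqt -foldl_nmul -foldl_cat cat_take_drop.
exists (n + m * n.+1)%N => x s szs sIJ.
have szn : size (take n s) = n by rewrite size_takel // szs leq_addr.
have xJ : foldl nmul x (take n s) \in J.
  apply: prodJ => // z; rewrite inE => /predU1P[->|/mem_take zs].
    by rewrite sIJ ?mem_head.
  by rewrite sIJ // inE zs orbT.
have [||t [szt tJ eqt]] := grp m (foldl nmul x (take n s)) (drop n s).
- by rewrite size_drop szs addKn.
- by move=> z /mem_drop zs; rewrite sIJ // inE zs orbT.
rewrite -(cat_take_drop n s) foldl_cat eqt nilJ // => z.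
by rewrite inE => /predU1P[->|/tJ].
Qed.

Lemma radical_exists : exists J, is_radical J.
Proof.
pose P n := `[< exists2 J, is_nilpotent_ideal J & \dim J = n >].
have exP : exists n, P n.
  by exists 0%N; apply/asboolP; exists 0%VS;
     [exact: is_nilpotent_ideal0 | rewrite dimv0].
have ubP n : P n -> (n <= \dim {:V})%N.
  by move=> /asboolP[J _ <-]; rewrite dimvS ?subvf.
have [n /asboolP[J nilJ dimJ] maxn] := ex_maxnP exP ubP.
exists J; split=> // I nilI.
have sJ : (J <= I + J)%VS by exact: addvSr.
suff -> : J = (I + J)%VS by exact: addvSl.
apply/eqP; rewrite eqEdim sJ dimJ maxn //.
by apply/asboolP; exists (I + J)%VS => //; exact: is_nilpotent_idealD.
Qed.

Definition rad : {vspace V} := sval (cid radical_exists).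

Lemma radP : is_radical rad.
Proof. exact: svalP (cid radical_exists). Qed.

(* Equivalent, for finite-dimensional algebras, to being a finite product of
   simple algebras that are not zero-product algebras; 0 is semisimple. *)
Definition semisimple : Prop := rad = 0%VS.

End Radical.

Arguments rad {k} V.
Arguments semisimple {k} V.

Section QuotientByRadical.
Variables (k : fieldType) (V : finNUAlgType k).

(* The k-algebra V / rad V, on the type of cosets of rad V. *)
Definition rad_quot : Type := Quotient.quot (rad V).
HB.instance Definition _ := GRing.Zmodule.on rad_quot.
HB.instance Definition _ := Quotient.on rad_quot.

Definition rad_class (x : V) : rad_quot := \pi_rad_quot x.

Lemma rad_classP x y : rad_class x = rad_class y <-> x - y \in rad V.
Proof.
by rewrite (@Quotient.idealrBE V (rad V)); split=> [/eqP|/eqP].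
Qed.

Lemma rad_class_repr (u : rad_quot) : rad_class (repr u) = u.
Proof. exact: reprK. Qed.

Lemma rad_classD x y : rad_class (x + y) = rad_class x + rad_class y.
Proof. exact: (raddfD \pi_(Quotient.quot (rad V))). Qed.

Definition rad_scale (a : k) (u : rad_quot) : rad_quot :=
  rad_class (a *: repr u).

Lemma rad_scaleE a x : rad_scale a (rad_class x) = rad_class (a *: x).
Proof.
apply/rad_classP; rewrite -scalerBr memvZ //.
by apply/rad_classP; rewrite rad_class_repr.
Qed.

Fact rad_scaleA a b u : rad_scale a (rad_scale b u) = rad_scale (a * b) u.
Proof. by rewrite -[u]rad_class_repr !rad_scaleE scalerA. Qed.

Fact rad_scale1 : left_id 1 rad_scale.
Proof. by move=> u; rewrite -[u]rad_class_repr !rad_scaleE scale1r. Qed.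

Fact rad_scaleDr : right_distributive rad_scale +%R.
Proof.
move=> a u v; rewrite -[u]rad_class_repr -[v]rad_class_repr.
by rewrite -rad_classD !rad_scaleE scalerDr rad_classD.
Qed.

Fact rad_scaleDl u : {morph rad_scale^~ u : a b / a + b}.
Proof.
by move=> a b; rewrite -[u]rad_class_repr !rad_scaleE scalerDl rad_classD.
Qed.

HB.instance Definition _ := GRing.Zmodule_isLmodule.Build k rad_quot
  rad_scaleA rad_scale1 rad_scaleDr rad_scaleDl.

Lemma rad_classZ a x : rad_class (a *: x) = a *: rad_class x.
Proof. by rewrite -rad_scaleE. Qed.

Definition rad_mul (u v : rad_quot) : rad_quot :=
  rad_class (repr u ** repr v).

Lemma rad_mulE x y : rad_mul (rad_class x) (rad_class y) = rad_class (x ** y).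
Proof.
have [[idR _] _] := radP V.
set x' := repr (rad_class x); set y' := repr (rad_class y).
have xJ : x' - x \in rad V by apply/rad_classP; exact: rad_class_repr.
have yJ : y' - y \in rad V by apply/rad_classP; exact: rad_class_repr.
apply/rad_classP.
rewrite -[X in X - _](subrK (x ** y')) -addrA -nmulBl -nmulBr.
by rewrite memvD //; [case: (idR y' _ xJ) | case: (idR x _ yJ)].
Qed.

Fact rad_mulA : associative rad_mul.
Proof.
move=> u v w; rewrite -[u]rad_class_repr -[v]rad_class_repr -[w]rad_class_repr.
by rewrite !rad_mulE nmulA.
Qed.

Fact rad_mul_linearl v : linear (rad_mul^~ v).
Proof.
move=> a u w; rewrite -[u]rad_class_repr -[v]rad_class_repr -[w]rad_class_repr.
rewrite -rad_classZ -rad_classD !rad_mulE.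
by rewrite -rad_classZ -rad_classD nmul_linearl.
Qed.

Fact rad_mul_linearr v : linear (rad_mul v).
Proof.
move=> a u w; rewrite -[u]rad_class_repr -[v]rad_class_repr -[w]rad_class_repr.
rewrite -rad_classZ -rad_classD !rad_mulE.
by rewrite -rad_classZ -rad_classD nmul_linearr.
Qed.

HB.instance Definition _ := isNonUnitalAlg.Build k rad_quot
  rad_mulA rad_mul_linearl rad_mul_linearr.

Lemma rad_class_is_alg_hom : is_alg_hom rad_class.
Proof.
split=> [a x y|x y]; first by rewrite rad_classD rad_classZ.
by rewrite -rad_mulE.
Qed.

End QuotientByRadical.

Arguments rad_quot {k} V.

Section Span.
Variables (k : fieldType) (V : vectType k) (S : set V).

Definition is_span (U : {vspace V}) : Prop :=
  (forall x, S x -> x \in U) /\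
  (forall W : {vspace V}, (forall x, S x -> x \in W) -> (U <= W)%VS).

Lemma span_exists : exists U, is_span U.
Proof.
pose P n :=
  `[< exists2 U : {vspace V}, (forall x, S x -> x \in U) & \dim U = n >].
have exP : exists n, P n.
  by exists (\dim {:V}); apply/asboolP; exists fullv => // x _; exact: memvf.
have [n /asboolP[U SU dimU] minn] := ex_minnP exP.
exists U; split=> // W SW.
suff <- : (U :&: W)%VS = U by exact: capvSr.
apply/eqP; rewrite eqEdim capvSl dimU minn //.
by apply/asboolP; exists (U :&: W)%VS => // x Sx; rewrite memv_cap SU ?SW.
Qed.

Definition set_span : {vspace V} := sval (cid span_exists).

Lemma set_spanP : is_span set_span.
Proof. exact: svalP (cid span_exists). Qed.

End Span.

Section GeneratedAlgebra.
Variables (k : fieldType) (g d : nat) (A : 'I_g -> 'M[k]_d).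

Definition word (i : 'I_g) (w : seq 'I_g) : 'M[k]_d :=
  foldl mulmx (A i) [seq A j | j <- w].

Definition gen_space : {vspace 'M[k]_d} :=
  set_span [set M | exists i w, M = word i w].

Lemma mem_word i w : word i w \in gen_space.
Proof.
have [+ _] := set_spanP [set M | exists i w, M = word i w].
by apply; exists i, w.
Qed.

Lemma word_mul i w j v : word i w *m word j v = word i (w ++ j :: v).
Proof.
rewrite /word map_cat foldl_cat /=; move: (foldl mulmx (A i) _) => M.
elim/last_ind: v => [//|v l IHv].
by rewrite map_rcons !foldl_rcons mulmxA IHv.
Qed.

Lemma gen_space_mul M N :
  M \in gen_space -> N \in gen_space -> M *m N \in gen_space.
Proof.
have [_ minU] := set_spanP [set M | exists i w, M = word i w].
have mulW i w P : P \in gen_space -> word i w *m P \in gen_space.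
  have /subvP/(_ P)/[apply] :
      (gen_space <= linfun (mulmx (word i w)) @^-1: gen_space)%VS.
    apply: minU => _ [j [v ->]].
    by rewrite -memv_preim lfunE /= word_mul mem_word.
  by rewrite -memv_preim lfunE.
move=> + NU; have /subvP/(_ M)/[apply] :
    (gen_space <= linfun (mulmxr N) @^-1: gen_space)%VS.
  by apply: minU => _ [j [v ->]]; rewrite -memv_preim lfunE /= mulW.
by rewrite -memv_preim lfunE.
Qed.

Definition gen_alg : Type := subvs_of gen_space.
HB.instance Definition _ := Vector.on gen_alg.

Definition gen_mul (x y : gen_alg) : gen_alg :=
  Subvs (gen_space_mul (subvsP x) (subvsP y)).

Fact gen_mulA : associative gen_mul.
Proof. by move=> x y z; apply: val_inj; rewrite /= mulmxA. Qed.

Fact gen_mul_linearl y : linear (gen_mul^~ y).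
Proof.
by move=> a x z; apply: val_inj; rewrite /= mulmxDl scalemxAl.
Qed.

Fact gen_mul_linearr y : linear (gen_mul y).
Proof.
by move=> a x z; apply: val_inj; rewrite /= mulmxDr scalemxAr.
Qed.

HB.instance Definition _ := isNonUnitalAlg.Build k gen_alg
  gen_mulA gen_mul_linearl gen_mul_linearr.

Definition gen (i : 'I_g) : gen_alg := Subvs (mem_word i [::]).

End GeneratedAlgebra.

(* A monic linear pencil I_d - \sum_i A_i x_i is given by its coefficients
   A : 'I_g -> 'M[k]_d. *)
Section FreeLocus.
Variables (k : fieldType) (g : nat).

Definition pencil_eval (d n : nat) (A : 'I_g -> 'M[k]_d)
    (X : 'I_g -> 'M[k]_n) : 'M[k]_(d * n) :=
  (1%:M *t 1%:M) - \sum_i (A i *t X i).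

(* The level n = 0 contributes no point, an empty determinant being 1. *)
Definition free_locus (d : nat) (A : 'I_g -> 'M[k]_d) :
    set {n : nat & 'I_g -> 'M[k]_n} :=
  [set X | \det (pencil_eval A (tagged X)) = 0].

(* Sizes of pencils are positive, so that pencils with empty free locus have
   minimal size 1 rather than 0. *)
Definition minimal (d : nat) (A : 'I_g -> 'M[k]_d) : Prop :=
  forall (m : nat) (B : 'I_g -> 'M[k]_m),
    (0 < m)%N -> free_locus B = free_locus A -> (d <= m)%N.

End FreeLocus.

(* Main.v *)
Require Import Defs.
From HB Require Import structures.
From mathcomp Require Import all_boot all_order all_algebra.
From mathcomp Require Import mxtens.
From mathcomp Require Import boolp classical_sets.

Set Implicit Arguments.
Unset Strict Implicit.
Unset Printing Implicit Defensive.

Import GRing.Theory.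
Local Open Scope ring_scope.
Local Open Scope classical_set_scope.

(* Writing a vector of k^d (x) k^n as a d x n matrix V, the point X lies in Z(L) iff
   V = \sum_i A_i V X_i^T for some V != 0. By Higman's linearization trick, Z(L) <= Z(L')
   then implies, for every noncommutative polynomial f without constant term, that f(A')
   has eigenvalue 1 as soon as f(A) does. Hence if f(A') lies in the radical, the ideal
   generated by f(A) consists of quasi-regular elements, so it is nilpotent by Nakayama's
   lemma. Conversely, if L'(X) is invertible, then Cayley-Hamilton provides a polynomial
   r with r(0) = 0, r(1) != 0 annihilating \sum_i A'_i (x) X_i; r(\sum_i A_i (x) X_i) has
   entries in the radical, so \sum_i A_i (x) X_i cannot have eigenvalue 1.

   For the second part, A and A' generate the same semisimple algebra R, and k^d, k^e are
   faithful R-modules. If U is a common submodule of maximal dimension, then U is faithful: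
   otherwise a minimal left ideal of R annihilating U embeds in both modules with image
   independent of U. By minimality of the pencils, U is all of k^d and of k^e. *)

(** A subspace of maximal dimension inside [S] contains every element of [S], since adding the line
    through such an element stays inside [S]. *)
Lemma linear_set_vspace (k : fieldType) (V : vectType k) (S : set V) :
  S 0 -> (forall a x y, S x -> S y -> S (a *: x + y)) ->
  exists U : {vspace V}, forall x, x \in U <-> S x.
Proof.
move=> S0 Slin.
pose P n := `[< exists2 U : {vspace V}, (forall x, x \in U -> S x) & \dim U = n >].
have exP : exists n, P n.
  exists 0%N; apply/asboolP; exists 0%VS; last by rewrite dimv0.
  by move=> x; rewrite memv0 => /eqP ->.
have ubP n : P n -> (n <= \dim {:V})%N.
  by move=> /asboolP[U _ <-]; rewrite dimvS ?subvf.
have [n /asboolP[U SU dimU] maxn] := ex_maxnP exP ubP.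
exists U => x; split=> [/SU//|Sx].
suff -> : U = (U + <[x]>)%VS by apply: (subvP (addvSr _ _)); exact: memv_line.
apply/eqP; rewrite eqEdim addvSl dimU maxn //.
apply/asboolP; exists (U + <[x]>)%VS => // _ /memv_addP[u uU [_ /vlineP[a ->] ->]].
by rewrite addrC; apply: Slin => //; exact: SU.
Qed.

(** * Kronecker products acting on matrices *)

Section Vectorization.
Variable k : fieldType.

Definition colvec (d n : nat) (V : 'M[k]_(d, n)) : 'cV[k]_(d * n) :=
  \col_i V (mxtens_unindex i).1 (mxtens_unindex i).2.

Lemma tensmx_colvec (d e n m : nat) (A : 'M[k]_(e, d)) (B : 'M[k]_(m, n)) V :
  (A *t B) *m colvec V = colvec (A *m V *m B^T).
Proof.
apply/colP=> i; case: (mxtens_indexP i) => {i} i j.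
rewrite !mxE mxtens_indexK /=.
under [RHS]eq_bigr do rewrite !mxE mulr_suml.
rewrite exchange_big /= pair_big /=.
rewrite (reindex (fun p => mxtens_index p)) /=; last first.
  by exists (@mxtens_unindex d n) => x _; rewrite ?mxtens_indexK ?mxtens_unindexK.
apply: eq_bigr => -[p q] _.
by rewrite tensmxE mxE mxtens_indexK -!mulrA [V _ _ * _]mulrC.
Qed.

Lemma colvec_inj (d n : nat) : injective (@colvec d n).
Proof.
move=> V W /colP VW; apply/matrixP=> i j.
by have := VW (mxtens_index (i, j)); rewrite !mxE mxtens_indexK.
Qed.

Lemma colvec_surj (d n : nat) (v : 'cV[k]_(d * n)) : exists V, v = colvec V.
Proof.
exists (\matrix_(i, j) v (mxtens_index (i, j)) 0).
by apply/colP=> i; rewrite !mxE -surjective_pairing mxtens_unindexK.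
Qed.

Lemma colvec0 (d n : nat) : colvec (0 : 'M[k]_(d, n)) = 0.
Proof. by apply/colP=> i; rewrite !mxE. Qed.

Lemma colvecZ (d n : nat) a (V : 'M[k]_(d, n)) : colvec (a *: V) = a *: colvec V.
Proof. by apply/colP=> i; rewrite !mxE. Qed.

Lemma colvec_lin (d n : nat) : linear (@colvec d n).
Proof. by move=> a V W; apply/colP=> i; rewrite !mxE. Qed.

HB.instance Definition _ (d n : nat) :=
  GRing.isLinear.Build k 'M[k]_(d, n) 'cV[k]_(d * n) _ (@colvec d n)
    (@colvec_lin d n).

Lemma det0_col (n : nat) (A : 'M[k]_n) :
  \det A = 0 <-> exists2 v : 'cV[k]_n, v != 0 & A *m v = 0.
Proof.
rewrite -det_tr; split=> [/eqP/det0P[v v0 vA]|[v v0 Av]].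
  exists v^T; first by rewrite trmx_eq0.
  by rewrite -[A]trmxK -trmx_mul vA trmx0.
by apply/eqP/det0P; exists v^T; rewrite ?trmx_eq0 // -trmx_mul Av trmx0.
Qed.

Lemma free_locusP (g d n : nat) (A : 'I_g -> 'M[k]_d) (X : 'I_g -> 'M[k]_n) :
  free_locus A (existT _ n X) <->
  exists2 V : 'M[k]_(d, n), V != 0 & \sum_i A i *m V *m (X i)^T = V.
Proof.
rewrite /free_locus /= det0_col /pencil_eval.
have E V : (1%:M *t 1%:M - \sum_i A i *t X i) *m colvec V =
    colvec (V - \sum_i A i *m V *m (X i)^T).
  rewrite [RHS]linearB [X in _ = _ - X]linear_sum mulmxBl tensmx_colvec.
  rewrite mul1mx trmx1 mulmx1 mulmx_suml; congr (_ - _).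
  by apply: eq_bigr => i _; rewrite tensmx_colvec.
split=> [[v]|[V V0 fixV]].
  have [V ->] := colvec_surj v; rewrite E => V0 fixV.
  exists V; first by apply: contraNneq V0 => ->; rewrite colvec0.
  apply/esym/eqP; rewrite -subr_eq0; apply/eqP.
  by apply: colvec_inj; rewrite fixV colvec0.
exists (colvec V); last by rewrite E fixV subrr colvec0.
by apply: contraNneq V0 => V0; apply/eqP/colvec_inj; rewrite V0 colvec0.
Qed.

End Vectorization.

(** * Linearization of noncommutative expressions *)

Section Expressions.
Variables (k : fieldType) (g : nat).

(* A term (C, (i, w)) stands for the noncommutative monomial x_i x_{w_1} x_{w_2} ...
   with matrix coefficient C, and a sequence of terms for their sum. *)
Definition term (n : nat) : Type := ('M[k]_n * ('I_g * seq 'I_g))%type.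

Definition mono (d : nat) (A : 'I_g -> 'M[k]_d) (w : 'I_g * seq 'I_g) : 'M[k]_d :=
  word A w.1 w.2.

Lemma mono_rcons (d : nat) (A : 'I_g -> 'M[k]_d) i w j :
  mono A (i, rcons w j) = mono A (i, w) *m A j.
Proof. by rewrite /mono /word map_rcons foldl_rcons. Qed.

Definition termop (d n : nat) (A : 'I_g -> 'M[k]_d) (s : seq (term n))
    (V : 'M[k]_(d, n)) : 'M[k]_(d, n) :=
  \sum_(t <- s) mono A t.2 *m V *m t.1.

Definition has_fixpoint (d n : nat) (A : 'I_g -> 'M[k]_d) (s : seq (term n)) :=
  exists2 V : 'M[k]_(d, n), V != 0 & termop A s V = V.

Definition split_term (n : nat) (C : 'M[k]_n) i w j (s : seq (term n)) :
    seq (term (n + n)) :=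
  [:: (block_mx 0 1%:M 0 0, (j, [::])), (block_mx 0 0 C 0, (i, w))
    & [seq (block_mx t.1 0 0 0, t.2) | t <- s]].

Lemma termop_split_term (d n : nat) (A : 'I_g -> 'M[k]_d) (C : 'M[k]_n) i w j s V1 V2 :
  termop A (split_term C i w j s) (row_mx V1 V2) =
  row_mx (mono A (i, w) *m V2 *m C + termop A s V1) (A j *m V1).
Proof.
rewrite /termop !big_cons big_map /= !mul_mx_row !mul_row_block.
rewrite !mulmx0 !mulmx1 !addr0 !add0r.
under eq_bigr do rewrite mul_mx_row mul_row_block !mulmx0 !addr0.
rewrite (_ : \sum_(t <- s) _ = row_mx (termop A s V1) 0); last first.
  rewrite /termop; elim/big_rec2: _ => [|t M N _ ->]; first by rewrite row_mx0.
  by rewrite add_row_mx addr0.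
by rewrite !add_row_mx !add0r !addr0.
Qed.

(* Higman's linearization trick: V1 = W A_j V1 C + F(V1) is equivalent to the
   system V1 = W V2 C + F(V1), V2 = A_j V1. *)
Lemma has_fixpoint_split_term (d n : nat) (A : 'I_g -> 'M[k]_d) (C : 'M[k]_n) i w j s :
  has_fixpoint A (split_term C i w j s) <->
  has_fixpoint A ((C, (i, rcons w j)) :: s).
Proof.
have cons_op V : termop A ((C, (i, rcons w j)) :: s) V =
    mono A (i, w) *m (A j *m V) *m C + termop A s V.
  by rewrite /termop big_cons mono_rcons /= !mulmxA.
split=> [[V V0 fixV]|[V V0 fixV]].
  move: V0 fixV; rewrite -[V]hsubmxK termop_split_term.
  set V1 := lsubmx V; set V2 := rsubmx V => V0 /eq_row_mx[fix1 fix2].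
  exists V1; last by rewrite cons_op fix2.
  by apply: contraNneq V0 => V10; rewrite -fix2 V10 mulmx0 row_mx0.
exists (row_mx V (A j *m V)); last by rewrite termop_split_term -cons_op fixV.
by apply: contraNneq V0; rewrite -row_mx0 => /eq_row_mx[-> _].
Qed.

Lemma has_fixpoint_perm (d n : nat) (A : 'I_g -> 'M[k]_d) (s s' : seq (term n)) :
  perm_eq s s' -> has_fixpoint A s -> has_fixpoint A s'.
Proof.
by move=> ss' [V V0 fixV]; exists V => //; rewrite -{2}fixV /termop (perm_big _ ss').
Qed.

(** Induction on the total length of the tails of the words: splitting off a last letter lowers it
    by one and doubles [n], which is why coefficients of all sizes occur. When every word is a
    single letter, the expression is the pencil at a point, and the hypothesis applies. *)
Lemma locus_has_fixpoint (d e : nat) (A : 'I_g -> 'M[k]_d) (A' : 'I_g -> 'M[k]_e) :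
  free_locus A `<=` free_locus A' ->
  forall n (s : seq (term n)), has_fixpoint A s -> has_fixpoint A' s.
Proof.
move=> AA' n s.
have [m] := ubnP (\sum_(t <- s) size t.2.2)%N.
elim: m => // m IHm in n s *; rewrite ltnS => les.
have [all0|/allPn[t ts]] := boolP (all (fun t : term n => nilp t.2.2) s).
  pose X i := (\sum_(t <- s | t.2.1 == i) t.1)^T.
  have opX c (B : 'I_g -> 'M[k]_c) V : termop B s V = \sum_i B i *m V *m (X i)^T.
    rewrite /termop (partition_big (fun t : term n => t.2.1) xpredT) //=.
    apply: eq_bigr => i _; rewrite trmxK mulmx_sumr big_seq_cond [RHS]big_seq_cond.
    apply: eq_bigr => -[C [l w]] /= /andP[/(allP all0)/nilP/= -> /eqP ->].
    by [].
  move=> [V V0 fixV]; have /AA'/free_locusP[W W0 fixW] : free_locus A (existT _ n X).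
    by apply/free_locusP; exists V => //; rewrite -opX.
  by exists W => //; rewrite opX.
have := perm_to_rem ts; case: t {ts} => C [i w]; case: (lastP w) => // {}w j ps _.
move=> fixs; apply: (@has_fixpoint_perm _ _ _ ((C, (i, rcons w j)) :: rem (C, (i, rcons w j)) s)).
  by rewrite perm_sym.
apply/has_fixpoint_split_term; apply: IHm.
  move: les; rewrite (perm_big _ ps) !big_cons big_map /= size_rcons addSn.
  by rewrite add0n.
by apply/has_fixpoint_split_term; apply: has_fixpoint_perm fixs.
Qed.

End Expressions.

(** * Elements of the generated algebra as values of polynomials *)

Section ScalarExpressions.
Variables (k : fieldType) (g : nat).

(** A noncommutative polynomial without constant term; several lists may stand for the same one. *)
Definition sexpr : Type := seq (k * ('I_g * seq 'I_g)).

Definition seval (d : nat) (A : 'I_g -> 'M[k]_d) (s : sexpr) : 'M[k]_d :=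
  \sum_(t <- s) t.1 *: mono A t.2.

Definition sscale (a : k) (s : sexpr) : sexpr := [seq (a * t.1, t.2) | t <- s].

Definition smul (s t : sexpr) : sexpr :=
  [seq (x.1 * y.1, (x.2.1, x.2.2 ++ y.2.1 :: y.2.2)) | x <- s, y <- t].

Section Evaluation.
Variables (d : nat) (A : 'I_g -> 'M[k]_d).

Lemma seval0 : seval A [::] = 0.
Proof. by rewrite /seval big_nil. Qed.

Lemma seval_cat s t : seval A (s ++ t) = seval A s + seval A t.
Proof. by rewrite /seval big_cat. Qed.

Lemma seval_scale a s : seval A (sscale a s) = a *: seval A s.
Proof.
by rewrite /seval big_map scaler_sumr; apply: eq_bigr => t _; rewrite scalerA.
Qed.

Lemma seval_mul s t : seval A (smul s t) = seval A s *m seval A t.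
Proof.
rewrite /seval /smul big_allpairs_dep mulmx_suml; apply: eq_bigr => x _.
rewrite mulmx_sumr; apply: eq_bigr => y _ /=.
by rewrite -scalemxAl -scalemxAr scalerA /mono word_mul.
Qed.

Lemma seval_mono w : seval A [:: (1, w)] = mono A w.
Proof. by rewrite /seval big_seq1 scale1r. Qed.

Lemma gen_spaceP M : M \in gen_space A <-> exists s, M = seval A s.
Proof.
split=> [|[s ->]]; last by apply: memv_suml => t _; rewrite memvZ // mem_word.
have [|a _ _ [s ->] [t ->]|U US] :=
    @linear_set_vspace k 'M[k]_d [set N | exists s, N = seval A s].
- by exists [::]; rewrite seval0.
- by exists (sscale a s ++ t); rewrite seval_cat seval_scale.
have [_ minU] := set_spanP [set N | exists i w, N = word A i w].
suff /subvP sU : (gen_space A <= U)%VS by move/sU/US.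
by apply: minU => _ [i [w ->]]; apply/US; exists [:: (1, (i, w))]; rewrite seval_mono.
Qed.

Lemma mem_seval s : seval A s \in gen_space A.
Proof. by apply/gen_spaceP; exists s. Qed.

Definition geval (s : sexpr) : gen_alg A := Subvs (mem_seval s).

Lemma geval_surj (x : gen_alg A) : exists s, geval s = x.
Proof.
have /gen_spaceP[s xs] := subvsP x.
by exists s; apply: val_inj.
Qed.

Lemma geval_lin a s t : geval (sscale a s ++ t) = a *: geval s + geval t.
Proof. by apply: val_inj; rewrite /= seval_cat seval_scale. Qed.

Lemma geval_mul s t : geval (smul s t) = nmul (geval s) (geval t).
Proof. by apply: val_inj; rewrite /= seval_mul. Qed.

Lemma geval_gen i : geval [:: (1, (i, [::]))] = gen A i.
Proof. by apply: val_inj; rewrite /= seval_mono. Qed.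

End Evaluation.

(** The transfer of fixpoints at [n = 1], where the coefficients are scalars. *)
Lemma locus_eigenvector (d e : nat) (A : 'I_g -> 'M[k]_d) (A' : 'I_g -> 'M[k]_e) :
  free_locus A `<=` free_locus A' ->
  forall s, (exists2 v : 'cV[k]_d, v != 0 & seval A s *m v = v) ->
    exists2 v : 'cV[k]_e, v != 0 & seval A' s *m v = v.
Proof.
move=> AA' s; pose S : seq (term k g 1) := [seq (t.1%:M, t.2) | t <- s].
have opS c (B : 'I_g -> 'M[k]_c) v : termop B S v = seval B s *m v.
  rewrite /termop /seval big_map mulmx_suml; apply: eq_bigr => t _ /=.
  by rewrite mul_mx_scalar scalemxAl.
move=> [v v0 fixv]; have [|w w0 fixw] := locus_has_fixpoint AA' (s := S).
  by exists v; rewrite // opS.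
by exists w; rewrite // -opS.
Qed.

End ScalarExpressions.

(** * Nilpotency and Nakayama's lemma *)

Section Nilpotency.
Variables (k : fieldType) (d : nat).
Implicit Types (J : set 'M[k]_d) (s : seq 'M[k]_d).

Definition nilpotent_set J : Prop :=
  exists N, forall s, size s = N -> (forall x, x \in s -> J x) ->
    foldl mulmx 1%:M s = 0.

Lemma foldl_mulmx (x : 'M[k]_d) s : foldl mulmx x s = x *m foldl mulmx 1%:M s.
Proof.
elim: s x => [|y s IHs] x /=; first by rewrite mulmx1.
by rewrite IHs [in RHS]IHs mul1mx mulmxA.
Qed.

Lemma nilpotent_set_fixed J (x : 'M[k]_d) : nilpotent_set J -> J x ->
  forall v : 'cV[k]_d, x *m v = v -> v = 0.
Proof.
move=> [N nilJ] Jx v xv.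
have pow n : foldl mulmx 1%:M (nseq n x) *m v = v.
  by elim: n => [|n IHn] /=; rewrite ?mul1mx // foldl_mulmx -mulmxA IHn.
by rewrite -(pow N) nilJ ?size_nseq ?mul0mx // => y /nseqP[->].
Qed.

(** Dividing by [c] and substituting the system into itself expresses each [v q] through ever longer
    products of elements of [J]. *)
Lemma nilpotent_system J n c (F : 'I_n -> 'I_n -> 'M[k]_d) (v : 'I_n -> 'cV[k]_d) :
  nilpotent_set J -> (forall p q, J (F p q)) -> c != 0 ->
  (forall q, \sum_p F q p *m v p = c *: v q) -> forall q, v q = 0.
Proof.
move=> [N nilJ] JF c0 Fv.
(* [m] counts the factors still missing from a vanishing product of length [N]; at [m = N] the
   product is empty. *)
suff kill m : (m <= N)%N -> forall s, size s = (N - m)%N ->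
    (forall x, x \in s -> J x) -> forall q, foldl mulmx 1%:M s *m v q = 0.
  move=> q; rewrite -[LHS]mul1mx; apply: (kill N (leqnn N) [::]) => //.
  by rewrite subnn.
elim: m => [_ s|m IHm mN s szs sJ q].
  by rewrite subn0 => szs sJ q; rewrite nilJ ?mul0mx.
have -> : v q = c^-1 *: (c *: v q) by rewrite scalerA mulVf // scale1r.
rewrite -Fv -scalemxAr mulmx_sumr big1 ?scaler0 // => p _.
rewrite mulmxA -foldl_rcons (IHm (ltnW mN)) ?size_rcons ?szs ?subnSK //.
by move=> x; rewrite mem_rcons inE => /predU1P[->|/sJ].
Qed.

Section Quasiregular.
Variable J : set 'M[k]_d.
Hypotheses (J0 : J 0) (Jlin : forall a x y, J x -> J y -> J (a *: x + y)).
Hypothesis JM : forall x y, J x -> J y -> J (x *m y).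
Hypothesis Jreg : forall x (v : 'M[k]_d), J x -> x *m v = v -> v = 0.

(** [J] acts by left multiplication on the whole matrix space, so that a product of its elements can
    be read off as its value at the identity matrix. *)
Definition stable (M : {vspace 'M[k]_d}) : Prop :=
  forall x v, J x -> v \in M -> x *m v \in M.

(* Nakayama: a maximal proper submodule N of M contains J M, as otherwise
   M = N + J v for some v, so that (1 - x) v lies in N for some x in J, whereas
   1 - x is injective and thus bijective on N. *)
Lemma stable_descent (M : {vspace 'M[k]_d}) : stable M -> M != 0%VS ->
  exists N : {vspace 'M[k]_d}, [/\ stable N, (\dim N < \dim M)%N
    & forall x v, J x -> v \in M -> x *m v \in N].
Proof.
move=> stM M0.
pose P n := `[< exists N : {vspace 'M[k]_d},
  [/\ stable N, (N <= M)%VS, (\dim N < \dim M)%N & \dim N = n] >].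
have exP : exists n, P n.
  exists 0%N; apply/asboolP; exists 0%VS; split; rewrite ?sub0v ?dimv0 ?lt0n ?dimv_eq0 //.
  by move=> x v _; rewrite !memv0 => /eqP->; rewrite mulmx0.
have ubP n : P n -> (n <= \dim M)%N by move=> /asboolP[N [_ _ /ltnW + <-]].
have [n /asboolP[N [stN NM ltNM dimN]] maxn] := ex_maxnP exP ubP.
exists N; split=> // x0 v Jx0 vM; apply/negPn/negP => x0vN.
have maxN K : stable K -> (N <= K)%VS -> (K <= M)%VS -> (\dim N < \dim K)%N -> K = M.
  move=> stK NK KM ltNK; apply/eqP; rewrite eqEdim KM leqNgt; apply/negP => ltKM.
  suff: (\dim K <= n)%N by rewrite -dimN leqNgt ltNK.
  by apply: maxn; apply/asboolP; exists K.
(* The submodule J v + N contains [x0 *m v], which is not in [N], so by maximality it is all of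
   [M]. *)
have [||K KP] := @linear_set_vspace k 'M[k]_d
    [set z | exists x y, [/\ J x, y \in N & z = x *m v + y]].
- by exists 0, 0; rewrite mul0mx addr0 mem0v.
- move=> a _ _ [x [y [Jx yN ->]]] [x' [y' [Jx' y'N ->]]].
  exists (a *: x + x'), (a *: y + y'); split; first exact: Jlin.
    by rewrite memvD ?memvZ.
  by rewrite mulmxDl -scalemxAl scalerDr addrACA.
have KM : K = M.
  apply: maxN.
  - move=> x _ Jx /KP[x' [y [Jx' yN ->]]]; apply/KP.
    exists (x *m x'), (x *m y); split; [exact: JM|exact: stN|].
    by rewrite mulmxDr mulmxA.
  - by apply/subvP => y yN; apply/KP; exists 0, y; rewrite mul0mx add0r.
  - apply/subvP => _ /KP[x [y [Jx yN ->]]].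
    by rewrite memvD //; [exact: stM | exact: (subvP NM)].
  apply: (@leq_trans (\dim (N + <[x0 *m v]>))).
    rewrite ltn_neqAle dimvS ?addvSl // andbT.
    apply: contraNneq x0vN => dimE.
    have /eqP-> : N == (N + <[x0 *m v]>)%VS by rewrite eqEdim addvSl dimE leqnn.
    by apply: (subvP (addvSr _ _)); exact: memv_line.
  apply: dimvS; rewrite subv_add; apply/andP; split.
    by apply/subvP => y yN; apply/KP; exists 0, y; rewrite mul0mx add0r.
  by rewrite -memvE; apply/KP; exists x0, 0; rewrite addr0 mem0v.
have /KP[x [y [Jx yN vE]]] : v \in K by rewrite KM.
pose f : 'End('M[k]_d) := linfun (fun u : 'M[k]_d => u - x *m u).
have fE u : f u = u - x *m u.
  rewrite /f; pose f' := idfun \- mulmx x : {linear 'M[k]_d -> 'M[k]_d}.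
  by rewrite (_ : (fun u => _) = f') // lfunE.
have kerf : lker f == 0%VS.
  rewrite -subv0; apply/subvP => u; rewrite memv_ker memv0 fE subr_eq0 => /eqP xu.
  by apply/eqP/(Jreg Jx).
have fN : (f @: N)%VS = N.
  apply/eqP; rewrite eqEdim limg_dim_eq ?leqnn ?andbT; last first.
    by rewrite (eqP kerf) capv0.
  apply/subvP => _ /memv_imgP[u uN ->].
  by rewrite fE memvB // stN.
(* [f v] is the vector [y] of [N]; injectivity of [f] then puts [v] itself in [N], and stability
   puts [x0 *m v] there. *)
have : f v \in (f @: N)%VS by rewrite fN fE {1}vE addrAC subrr add0r.
move=> /memv_imgP[u uN /(lker0P kerf) vu].
by case/negP: x0vN; rewrite vu stN.
Qed.

(** Each factor, from the right, moves a stable subspace into one of smaller dimension, so products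
    as long as the dimension of the matrix space vanish. *)
Lemma quasiregular_nilpotent : nilpotent_set J.
Proof.
suff kill m (M : {vspace 'M[k]_d}) : stable M -> (\dim M <= m)%N -> forall s, size s = m ->
    (forall x, x \in s -> J x) -> forall v, v \in M -> foldl mulmx 1%:M s *m v = 0.
  exists (\dim {:'M[k]_d}) => s szs sJ; rewrite -[foldl _ _ _]mulmx1.
  by apply: kill szs sJ _ _ => // [x v _ _|]; exact: memvf.
elim: m M => [|m IHm] M stM dimM s szs sJ v vM.
  move: vM; have /eqP-> : M == 0%VS by rewrite -dimv_eq0 -leqn0.
  by rewrite memv0 => /eqP->; rewrite mulmx0.
have [M0|M0] := eqVneq M 0%VS.
  by move: vM; rewrite M0 memv0 => /eqP->; rewrite mulmx0.
have [N [stN ltN JMN]] := stable_descent stM M0.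
case: (lastP s) => [|s' x] in szs sJ *; first by move: szs.
rewrite foldl_rcons -mulmxA; apply: (IHm N) => //.
- by rewrite -ltnS (leq_trans ltN).
- by move: szs; rewrite size_rcons => -[].
- by move=> y ys; apply: sJ; rewrite mem_rcons inE ys orbT.
- by apply: JMN vM; apply: sJ; rewrite mem_rcons mem_head.
Qed.

End Quasiregular.
End Nilpotency.

Local Notation rad := Defs.rad.

(** * The radical as a set of matrices *)

Section RadicalAsMatrices.
Variables (k : fieldType) (g d : nat) (A : 'I_g -> 'M[k]_d).

Definition radset : set 'M[k]_d :=
  [set M | exists2 x : gen_alg A, x \in rad (gen_alg A) & val x = M].

Lemma val_foldl_nmul (x : gen_alg A) s :
  val (foldl nmul x s) = foldl mulmx (val x) [seq val y | y <- s].
Proof. by elim: s x => //= y s IHs x; rewrite IHs. Qed.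

Lemma radset_nilpotent : nilpotent_set radset.
Proof.
have [[_ [n nilR]] _] := radP (gen_alg A).
(* In [is_nilpotent], [n] counts the factors after the first. *)
exists n.+1 => s szs sR.
have [xs [eqs xsR]] : exists xs : seq (gen_alg A),
    [seq val x | x <- xs] = s /\ {subset xs <= rad (gen_alg A)}.
  elim: s {szs} sR => [|M s IHs] sR; first by exists [::].
  have [x xR xM] := sR M (mem_head _ _).
  have [y ys|xs [eqs xsR]] := IHs; first by apply: sR; rewrite inE ys orbT.
  exists (x :: xs); split; first by rewrite /= eqs xM.
  by move=> y; rewrite inE => /predU1P[->|/xsR].
case: xs => [|x xs] in eqs xsR *; first by rewrite -eqs in szs.
rewrite -eqs /= mul1mx -val_foldl_nmul nilR //.
by move: szs; rewrite -eqs size_map /= => -[].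
Qed.

(** The elements of the algebra that lie in [J] form a nilpotent ideal, and the radical contains
    every such ideal. *)
Lemma nilpotent_set_rad (J : set 'M[k]_d) :
  J 0 -> (forall a x y, J x -> J y -> J (a *: x + y)) ->
  (forall x y, J x -> y \in gen_space A -> J (x *m y) /\ J (y *m x)) ->
  nilpotent_set J -> forall x : gen_alg A, J (val x) -> x \in rad (gen_alg A).
Proof.
move=> J0 Jlin Jid [N nilJ] x Jx.
have [//|a u v Ju Jv|U UJ] :=
  @linear_set_vspace k (gen_alg A) [set y | J (val y)]; first exact: Jlin.
have [_ /(_ U) maxR] := radP (gen_alg A).
apply: (subvP (maxR _)); last exact/UJ.
split=> [u v /UJ Jv|].
  by have [Jvu Juv] := Jid _ _ Jv (subvsP u); split; apply/UJ.
exists N => u s szs sU; apply: val_inj; rewrite val_foldl_nmul foldl_mulmx.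
rewrite nilJ ?mulmx0 ?size_map // => _ /mapP[y ys ->].
by apply/UJ/sU; rewrite inE ys orbT.
Qed.

End RadicalAsMatrices.

(** * Containment of loci yields a homomorphism *)

Section RadicalTransfer.
Variables (k : fieldType) (g d e : nat).
Variables (A : 'I_g -> 'M[k]_d) (A' : 'I_g -> 'M[k]_e).
Hypothesis AA' : free_locus A `<=` free_locus A'.

Lemma rad_transfer s :
  geval A' s \in rad (gen_alg A') -> geval A s \in rad (gen_alg A).
Proof.
(* The values at [A] of the expressions that are radical at [A'] form an ideal. None of them fixes a
   nonzero vector, because its counterpart at [A'] would too, against nilpotency. *)
pose J : set 'M[k]_d :=
  [set M | exists2 t, geval A' t \in rad (gen_alg A') & M = seval A t].
have [[idR _] _] := radP (gen_alg A').
have g0 : geval A' [::] = 0 by apply: val_inj; rewrite /= seval0.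
have J0 : J 0 by exists [::]; rewrite ?seval0 // g0 mem0v.
have Jlin a x y : J x -> J y -> J (a *: x + y).
  move=> [t tR ->] [u uR ->]; exists (sscale a t ++ u).
    by rewrite geval_lin memvD ?memvZ.
  by rewrite seval_cat seval_scale.
have Jid x y : J x -> y \in gen_space A -> J (x *m y) /\ J (y *m x).
  move=> [t tR ->] /gen_spaceP[u ->]; have [utR tuR] := idR (geval A' u) _ tR.
  split; first by exists (smul t u); rewrite ?seval_mul // geval_mul.
  by exists (smul u t); rewrite ?seval_mul // geval_mul.
move=> sR; apply: (nilpotent_set_rad J0 Jlin Jid); last by exists s.
apply: quasiregular_nilpotent => //.
  by move=> x y Jx [t _ ->]; have [] := Jid _ (seval A t) Jx (mem_seval A t).
move=> _ v [t tR ->] tv; apply/eqP/negPn/negP => v0.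
have [j vj] : exists j, col j v != 0.
  apply/existsP; rewrite -negb_forall; apply: contraNN v0 => /forallP v0.
  apply/eqP/matrixP=> i j; have /eqP/colP/(_ i) := v0 j.
  by rewrite !mxE.
have [|w w0 tw] := locus_eigenvector AA' (s := t).
  by exists (col j v); rewrite // -[in RHS]tv !colE mulmxA.
case/eqP: w0; apply: nilpotent_set_fixed (radset_nilpotent A') _ _ tw.
by exists (geval A' t).
Qed.

Lemma rad_quot_hom : exists phi : rad_quot (gen_alg A') -> rad_quot (gen_alg A),
  is_alg_hom phi /\ forall i, phi (rad_class (gen A' i)) = rad_class (gen A i).
Proof.
have ex_s (u : rad_quot (gen_alg A')) : exists s, rad_class (geval A' s) = u.
  by have [s sE] := geval_surj (repr u); exists s; rewrite sE rad_class_repr.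
(* Any expression representing the class [u] may be chosen: two choices differ by an expression that
   is radical at [A'], hence at [A]. *)
pose phi u := rad_class (geval A (sval (cid (ex_s u)))).
have phiE s : phi (rad_class (geval A' s)) = rad_class (geval A s).
  rewrite /phi; case: (cid _) => t /= /rad_classP tsR; apply/rad_classP.
  have gB c (B : 'I_g -> 'M[k]_c) :
      geval B t - geval B s = geval B (sscale (-1) s ++ t).
    by rewrite geval_lin scaleN1r addrC.
  by move: tsR; rewrite !gB => /rad_transfer.
have [lin mul] := rad_class_is_alg_hom (gen_alg A).
have [lin' mul'] := rad_class_is_alg_hom (gen_alg A').
exists phi; split; last by move=> i; rewrite -!geval_gen phiE.
split=> [a u v|u v]; have [s <-] := ex_s u; have [t <-] := ex_s v.
  by rewrite -lin' -geval_lin !phiE geval_lin lin.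
by rewrite -mul' -geval_mul !phiE geval_mul mul.
Qed.

End RadicalTransfer.

(** Multiplicativity handles words, letter by letter from the right, and linearity handles sums. *)
Lemma rad_quot_hom_geval (k : fieldType) (g d e : nat)
    (A : 'I_g -> 'M[k]_d) (A' : 'I_g -> 'M[k]_e)
    (phi : rad_quot (gen_alg A') -> rad_quot (gen_alg A)) :
  is_alg_hom phi -> (forall i, phi (rad_class (gen A' i)) = rad_class (gen A i)) ->
  forall s, phi (rad_class (geval A' s)) = rad_class (geval A s).
Proof.
move=> [phil phim] phig.
have [lin mul] := rad_class_is_alg_hom (gen_alg A).
have [lin' mul'] := rad_class_is_alg_hom (gen_alg A').
have g0 c (B : 'I_g -> 'M[k]_c) : geval B [::] = 0 by apply: val_inj; rewrite /= seval0.
have phi0 : phi 0 = 0.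
  by have := phil (-1) 0 0; rewrite scaleN1r addNr => ->; rewrite scaleN1r addNr.
have class0 c (B : 'I_g -> 'M[k]_c) : rad_class (0 : gen_alg B) = 0.
  have [linB _] := rad_class_is_alg_hom (gen_alg B).
  by have := linB (-1) 0 0; rewrite scaleN1r addNr => ->; rewrite scaleN1r addNr.
have phiw w : phi (rad_class (geval A' [:: (1, w)])) = rad_class (geval A [:: (1, w)]).
  case: w => i w; elim/last_ind: w => [|w j IHw]; first by rewrite !geval_gen.
  have gM c (B : 'I_g -> 'M[k]_c) :
      geval B [:: (1, (i, rcons w j))] = nmul (geval B [:: (1, (i, w))]) (gen B j).
    by apply: val_inj; rewrite /= !seval_mono mono_rcons.
  by rewrite !gM mul' phim IHw phig mul.
elim=> [|[a w] s IHs]; first by rewrite !g0 !class0 phi0.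
have gC c (B : 'I_g -> 'M[k]_c) :
    geval B ((a, w) :: s) = a *: geval B [:: (1, w)] + geval B s.
  by apply: val_inj; rewrite /= seval_mono /seval big_cons.
by rewrite !gC lin' phil IHs phiw lin.
Qed.

(** * A homomorphism yields containment of loci *)

Section Containment.
Variables (k : fieldType) (g : nat).

Definition pencil_part (d n : nat) (A : 'I_g -> 'M[k]_d) (X : 'I_g -> 'M[k]_n) :
    'M[k]_(d * n) := \sum_i A i *t X i.

Definition tens_eval (d n : nat) (A : 'I_g -> 'M[k]_d) (S : seq (term k g n)) :
    'M[k]_(d * n) := \sum_(t <- S) mono A t.2 *t t.1.

Lemma tensmx_scaler (d n : nat) a (M : 'M[k]_d) (C : 'M[k]_n) :
  M *t (a *: C) = a *: (M *t C).
Proof. by apply/matrixP=> i j; rewrite !mxE mulrCA. Qed.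

(** The list [S] depends only on [X] and [m], so that one expression can be compared at [A'] and at
    [A]. *)
Lemma pencil_part_pow (n : nat) (X : 'I_g -> 'M[k]_n) m :
  exists S, forall d (A : 'I_g -> 'M[k]_d), pencil_part A X ^+ m.+1 = tens_eval A S.
Proof.
elim: m => [|m [S SE]].
  exists [seq (X i, (i, [::])) | i <- index_enum 'I_g] => d A.
  by rewrite expr1 /tens_eval big_map.
exists [seq (t.1 *m X i, (t.2.1, rcons t.2.2 i)) | t <- S, i <- index_enum 'I_g] => d A.
rewrite exprSr -mulmxE SE /tens_eval big_allpairs_dep mulmx_suml; apply: eq_bigr => -[C [j w]] _.
by rewrite mulmx_sumr; apply: eq_bigr => i _; rewrite tensmx_mul /= -mono_rcons.
Qed.

Lemma pencil_part_poly (n : nat) (X : 'I_g -> 'M[k]_n) (c : nat -> k) N :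
  exists S, forall d (A : 'I_g -> 'M[k]_d),
    \sum_(i < N) c i *: pencil_part A X ^+ i.+1 = tens_eval A S.
Proof.
elim: N => [|N [S SE]].
  by exists [::] => d A; rewrite big_ord0 /tens_eval big_nil.
have [S' SE'] := pencil_part_pow X N.
exists (S ++ [seq (c N *: t.1, t.2) | t <- S']) => d A.
rewrite big_ord_recr /= SE SE' /tens_eval big_cat big_map scaler_sumr; congr (_ + _).
by apply: eq_bigr => t _; rewrite tensmx_scaler.
Qed.

(** The characteristic polynomial is nonzero at 1 because 1 is not an eigenvalue. Multiplying the
    Cayley-Hamilton identity by [M] removes the constant term: the annihilating polynomial is the
    variable times [r], with the same value at 1 as [r]. *)
Lemma annihilating_poly N (M : 'M[k]_N) :
  (forall v : 'cV[k]_N, M *m v = v -> v = 0) ->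
  exists2 r : {poly k}, r.[1] != 0 & \sum_(i < size r) r`_i *: M ^+ i.+1 = 0.
Proof.
(* In size zero all matrices are equal, so the constant 1 serves as [r]. *)
case: N M => [|N] M M1.
  by exists 1; rewrite ?hornerC ?oner_eq0 //; apply/matrixP=> -[].
exists (char_poly M).
  apply: contraTneq isT => /eqP; rewrite -[_ == 0]/(root _ 1) -eigenvalue_root_char.
  (* [eigenvalue] concerns row vectors; the determinant of [1%:M - M] turns a fixed row into a fixed
     column. *)
  move=> /eigenvalueP[v vM v0].
  suff /det0_col[w w0] : \det (1%:M - M) = 0.
    by rewrite mulmxBl mul1mx => /eqP; rewrite subr_eq0 => /eqP/esym/M1/eqP; rewrite (negPf w0).
  by apply/eqP/det0P; exists v => //; rewrite mulmxBr mulmx1 vM scale1r subrr.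
have := Cayley_Hamilton M; rewrite /horner_mx /horner_morph.
move=> /(congr1 ( *%R^~ M)); rewrite mul0r => CH; rewrite -[RHS]CH.
rewrite horner_coef size_map_poly mulr_suml; apply: eq_bigr => i _.
by rewrite coef_map /= -mulrA -exprSr -mulmxE mul_scalar_mx.
Qed.

(* If L' is invertible at X, a polynomial r with r(0) = 0 and r(1) != 0 annihilates
   T' = \sum_i A'_i (x) X_i, so the blocks of r(T) lie in K. As r(T) acts as r(1) on a
   fixed vector of T, nilpotency of K forces that vector to vanish. *)
Lemma locus_sub (d e : nat) (A : 'I_g -> 'M[k]_d) (A' : 'I_g -> 'M[k]_e) (K : set 'M[k]_d) :
  nilpotent_set K -> (forall s, seval A' s = 0 -> K (seval A s)) ->
  free_locus A `<=` free_locus A'.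
Proof.
move=> nilK AK [n X] /free_locusP[V V0 fixV].
apply: contrapT => /free_locusP noW.
have penE c (B : 'I_g -> 'M[k]_c) (U : 'M[k]_(c, n)) :
    pencil_part B X *m colvec U = colvec (\sum_i B i *m U *m (X i)^T).
  rewrite /pencil_part mulmx_suml [RHS]linear_sum; apply: eq_bigr => i _.
  by rewrite tensmx_colvec.
have [v|r r1 rT] := @annihilating_poly _ (pencil_part A' X).
  have [W ->] := colvec_surj v; rewrite penE => /colvec_inj fixW.
  have [->|W0] := eqVneq W 0; first by rewrite colvec0.
  by case: noW; exists W.
have [S SE] := pencil_part_poly X (nth 0 r) (size r).
(* [ent p q] is the part of [tens_eval] at entry (p, q) of the second tensor factor, as an
   expression with scalar coefficients. *)
pose ent (p q : 'I_n) : sexpr k g := [seq ((t : term k g n).1 p q, t.2) | t <- S].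
have ent0 p q : seval A' (ent p q) = 0.
  apply/matrixP=> i j; have /matrixP := rT; rewrite SE.
  move=> /(_ (mxtens_index (i, p)) (mxtens_index (j, q))); rewrite !mxE => E; rewrite -[RHS]E.
  rewrite /seval big_map !summxE; apply: eq_bigr => t _.
  by rewrite tensmxE !mxE mulrC.
have fixS : \sum_(t <- S) mono A t.2 *m V *m t.1^T = r.[1] *: V.
  apply: colvec_inj; rewrite linear_sum colvecZ.
  transitivity (tens_eval A S *m colvec V).
    by rewrite mulmx_suml; apply: eq_bigr => t _; rewrite tensmx_colvec.
  rewrite -SE mulmx_suml horner_coef scaler_suml; apply: eq_bigr => i _.
  rewrite expr1n mulr1 -scalemxAl; congr (_ *: _).
  elim: {i}(i : nat) => [|i IHi]; first by rewrite expr1 penE fixV.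
  by rewrite exprSr -mulmxE -mulmxA penE fixV.
case/eqP: V0; apply/matrixP=> i q.
have /colP/(_ i) : col q V = 0; last by rewrite !mxE.
(* Read column by column, [fixS] is a linear system with coefficients in [K] and scalar [r.[1]]. *)
apply: (nilpotent_system (F := fun p q => seval A (ent p q))
  (v := fun p => col p V) nilK _ r1) => [p q'|q'].
  exact/AK/ent0.
apply/colP=> l; have /matrixP/(_ l q') := fixS; rewrite !mxE => <-.
rewrite !summxE; under eq_bigr do rewrite /seval big_map mulmx_suml summxE.
rewrite exchange_big /=. apply: eq_bigr => t _; rewrite mxE.
apply: eq_bigr => p _; rewrite -scalemxAl colE mulmxA -colE.
by rewrite mxE [X in _ * X = _]mxE [RHS]mulrC; congr (_ * _); rewrite mxE.
Qed.

End Containment.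

Lemma left_inverse_cV (k : fieldType) (d r : nat) (M : 'M[k]_(d, r)) :
  (forall v : 'cV[k]_r, M *m v = 0 -> v = 0) -> exists M', M' *m M = 1%:M.
Proof.
move=> injM; have /row_freeP[M' MM'] : row_free M^T.
  apply: inj_row_free => v vM; apply: trmx_inj; rewrite trmx0; apply: injM.
  by rewrite -[M]trmxK -trmx_mul vM trmx0.
by exists M'^T; apply: trmx_inj; rewrite trmx_mul trmxK MM' trmx1.
Qed.

(** * Intertwining matrices *)

Section Intertwining.
Variables (k : fieldType) (g : nat).

Definition intertwines (d r : nat) (D : 'I_g -> 'M[k]_d) (C : 'I_g -> 'M[k]_r)
  (M : 'M[k]_(d, r)) : Prop := forall i, D i *m M = M *m C i.

Lemma intertwines_seval (d r : nat) (D : 'I_g -> 'M[k]_d) (C : 'I_g -> 'M[k]_r) M s :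
  intertwines D C M -> seval D s *m M = M *m seval C s.
Proof.
move=> DC; rewrite /seval mulmx_suml mulmx_sumr; apply: eq_bigr => -[a [i w]] _ /=.
rewrite -scalemxAl -scalemxAr; congr (_ *: _).
elim/last_ind: w => [|w j IHw]; first exact: DC.
by rewrite !mono_rcons -mulmxA DC mulmxA IHw mulmxA.
Qed.

Lemma nilpotent_set0 d : nilpotent_set [set 0 : 'M[k]_d].
Proof.
exists 1%N => -[|x []] //= _ x0.
by rewrite (x0 x) ?mulmx0 // mem_head.
Qed.

Lemma locus_sub0 (d e : nat) (A : 'I_g -> 'M[k]_d) (A' : 'I_g -> 'M[k]_e) :
  (forall s, seval A' s = 0 -> seval A s = 0) -> free_locus A `<=` free_locus A'.
Proof. exact: locus_sub (@nilpotent_set0 d). Qed.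

(** Conjugate families satisfy the same relations, and the relations determine the locus by
    [locus_sub0]. *)
Lemma locus_similar (d : nat) (A A' : 'I_g -> 'M[k]_d) P :
  P \in unitmx -> intertwines A' A P -> free_locus A = free_locus A'.
Proof.
move=> Pu AP; apply/seteqP; split; apply: locus_sub0 => s s0.
  have := intertwines_seval s AP; rewrite s0 mul0mx => /(congr1 (mulmx (invmx P))).
  by rewrite mulmx0 mulKmx.
have := intertwines_seval s AP; rewrite s0 mulmx0 => /(congr1 (mulmx^~ (invmx P))).
by rewrite mul0mx mulmxK.
Qed.

Definition slincomb m (c : 'I_m -> k) (t : 'I_m -> sexpr k g) : sexpr k g :=
  flatten [seq sscale (c l) (t l) | l <- index_enum 'I_m].

Lemma seval_slincomb d (D : 'I_g -> 'M[k]_d) m (c : 'I_m -> k) t :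
  seval D (slincomb c t) = \sum_l c l *: seval D (t l).
Proof.
rewrite /slincomb; elim: (index_enum _) => [|l s IHs]; first by rewrite big_nil seval0.
by rewrite big_cons /= seval_cat seval_scale IHs.
Qed.

End Intertwining.

(** * Left ideals of a semisimple matrix algebra *)

Section SemisimpleModules.
Variables (k : fieldType) (g d : nat) (A : 'I_g -> 'M[k]_d).
Hypothesis ssA : semisimple (gen_alg A).

Definition left_ideal (L : {vspace 'M[k]_d}) : Prop :=
  (L <= gen_space A)%VS /\ forall s x, x \in L -> seval A s *m x \in L.

(* Such an L lies both in its left annihilator K and in the right annihilator of K,
   and the intersection of the two is a square-zero ideal. *)
Lemma left_ideal_sqr0 L : left_ideal L ->
  (forall x y, x \in L -> y \in L -> x *m y = 0) -> L = 0%VS.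
Proof.
move=> [Lgen Lid] LL; apply/eqP; rewrite -subv0; apply/subvP => x xL.
pose K : set 'M[k]_d := [set y | y \in gen_space A /\ forall l, l \in L -> y *m l = 0].
pose J : set 'M[k]_d := [set y | K y /\ forall z, K z -> z *m y = 0].
have xgen := subvP Lgen x xL.
suff : Subvs xgen \in rad (gen_alg A) by rewrite ssA !memv0 => /eqP/(congr1 val)/= ->.
apply: (@nilpotent_set_rad _ _ _ _ J).
- split=> [|z _]; last by rewrite mulmx0.
  by split=> [|l _]; rewrite ?mem0v ?mul0mx.
- move=> a y z [[yg yL] yK] [[zg zL] zK]; split; last first.
    by move=> u Ku; rewrite mulmxDr -scalemxAr yK // zK // scaler0 addr0.
  split=> [|l lL]; first by rewrite memvD ?memvZ.
  by rewrite mulmxDl -scalemxAl yL // zL // scaler0 addr0.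
- move=> y z [[yg yL] yK] zg; have [s zE] := (gen_spaceP A z).1 zg.
  split; split.
  + split=> [|l lL]; first exact: gen_space_mul.
    by rewrite -mulmxA yL // zE Lid.
  + by move=> u Ku; rewrite mulmxA yK ?mul0mx.
  + split=> [|l lL]; first exact: gen_space_mul.
    by rewrite -mulmxA yL // mulmx0.
  + move=> u [ug uL]; rewrite mulmxA yK //; split=> [|l lL]; first exact: gen_space_mul.
    by rewrite -mulmxA uL // zE Lid.
- exists 2%N => -[|y [|z []]] //= _ sJ; rewrite mul1mx.
  have [Ky _] := sJ y (mem_head _ _).
  have [_ zK] : J z by apply: sJ; rewrite !inE eqxx orbT.
  exact: zK.
- split=> [|z [_ zL]]; last exact: zL.
  by split=> // l lL; exact: LL.
Qed.

Definition minimal_left_ideal (L : {vspace 'M[k]_d}) : Prop :=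
  [/\ left_ideal L, L != 0%VS &
      forall L', left_ideal L' -> (L' <= L)%VS -> L' != 0%VS -> L' = L].

Lemma minimal_left_ideal_exists I : left_ideal I -> I != 0%VS ->
  exists2 L, minimal_left_ideal L & (L <= I)%VS.
Proof.
move=> idI I0.
pose P n := `[< exists L, [/\ left_ideal L, L != 0%VS, (L <= I)%VS & \dim L = n] >].
have exP : exists n, P n by exists (\dim I); apply/asboolP; exists I.
have [n /asboolP[L [idL L0 LI dimL]] minn] := ex_minnP exP.
exists L => //; split=> // L' idL' L'L L'0; apply/eqP; rewrite eqEdim L'L dimL minn //.
by apply/asboolP; exists L'; split=> //; exact: subv_trans LI.
Qed.

(** The elements of [L] satisfying [Q] form a nonzero left ideal inside [L], hence all of [L]. *)
Lemma minimal_left_ideal_all L (Q : set 'M[k]_d) : minimal_left_ideal L ->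
  Q 0 -> (forall a x y, Q x -> Q y -> Q (a *: x + y)) ->
  (forall s x, Q x -> Q (seval A s *m x)) ->
  (exists x, [/\ x \in L, x != 0 & Q x]) -> forall x, x \in L -> Q x.
Proof.
move=> [[Lgen Lid] L0 minL] Q0 Qlin Qid [x [xL x0 Qx]] y yL.
have [U UQ] := linear_set_vspace Q0 Qlin.
suff LU : (L :&: U)%VS = L by apply/UQ/(subvP (capvSr L U)); rewrite LU.
apply: minL; rewrite ?capvSl //.
  split=> [|s z]; first exact: subv_trans (capvSl _ _) Lgen.
  by rewrite !memv_cap => /andP[zL /UQ Qz]; rewrite Lid //; apply/UQ/Qid.
apply: contraNneq x0 => LU0; rewrite -memv0 -LU0 memv_cap xL; exact/UQ.
Qed.

(** * Enlarging a submodule by a minimal left ideal *)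

Section ExtendIntertwiner.
Variables (r : nat) (C : 'I_g -> 'M[k]_r) (L : {vspace 'M[k]_d}).
Hypothesis minL : minimal_left_ideal L.
Hypothesis LC : forall s, seval A s \in L -> seval C s = 0.

Let idL : left_ideal L. Proof. by case: minL. Qed.
Let L0 : L != 0%VS. Proof. by case: minL. Qed.

Section FaithfulModule.
Variables (c : nat) (D : 'I_g -> 'M[k]_c) (M : 'M[k]_(c, r)).
Hypothesis AD : forall s, seval A s = 0 <-> seval D s = 0.
Hypothesis DC : intertwines D C M.

Let AD_eq s t : seval A s = seval A t -> seval D s = seval D t.
Proof.
have B b (B : 'I_g -> 'M[k]_b) : seval B (sscale (-1) t ++ s) = seval B s - seval B t.
  by rewrite seval_cat seval_scale scaleN1r addrC.
move=> st; apply/eqP; rewrite -subr_eq0 -B; apply/eqP/AD.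
by rewrite B st subrr.
Qed.

(** Choose [v] not killed by [L]. If some nonzero element of [L] sent [v] into the image of [M],
    then by minimality all of [L] would. As [L] acts as zero on that image, products of two elements
    of [L] would kill [v]; some such product is nonzero by semisimplicity, so by minimality [L]
    would kill [v]. *)
Lemma generic_vector : exists v : 'cV[k]_c, forall s u,
  seval A s \in L -> seval D s *m v = M *m u -> seval A s = 0.
Proof.
have [x0 x0L nz0] : exists2 x, x \in L & x != 0.
  by exists (vpick L); rewrite ?memv_pick ?vpick0.
have [s0 x0E] := (gen_spaceP A x0).1 (subvP idL.1 x0 x0L).
have [v Dv] : exists v : 'cV[k]_c, seval D s0 *m v != 0.
  apply: contrapT => /forallNP Dv0; case/eqP: nz0; rewrite x0E; apply/AD.
  apply/matrixP=> i j; have /negP/negPn/eqP/colP/(_ i) := Dv0 (delta_mx j 0).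
  by rewrite -colE !mxE.
exists v => s u sL sv; apply/eqP/negPn/negP => nzs.
pose Q : set 'M[k]_d := [set x | exists t w, x = seval A t /\ seval D t *m v = M *m w].
have allQ : forall x, x \in L -> Q x.
  apply: (minimal_left_ideal_all minL).
  - by exists [::], 0; rewrite !seval0 mul0mx mulmx0.
  - move=> a _ _ [t [w [-> tw]]] [t' [w' [-> tw']]].
    exists (sscale a t ++ t'), (a *: w + w'); rewrite !seval_cat !seval_scale.
    by rewrite mulmxDl -scalemxAl tw tw' mulmxDr -scalemxAr.
  - move=> q _ [t [w [-> tw]]]; exists (smul q t), (seval C q *m w).
    by rewrite !seval_mul -mulmxA tw !mulmxA (intertwines_seval _ DC).
  - by exists (seval A s); split=> //; exists s, u.
pose Q' : set 'M[k]_d := [set x | exists t, x = seval A t /\ seval D t *m v = 0].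
have Q'mul x y : x \in L -> y \in L -> Q' (x *m y).
  move=> xL /allQ[t [w [-> tw]]].
  have [q xE] := (gen_spaceP A x).1 (subvP idL.1 x xL).
  exists (smul q t); rewrite !seval_mul -xE -mulmxA tw mulmxA.
  by rewrite (intertwines_seval _ DC) LC -?xE // mulmx0 mul0mx.
case/eqP: L0; apply: (left_ideal_sqr0 idL) => x y xL yL.
apply/eqP/negPn/negP => xy0.
suff [t [tE tv]] : Q' x0.
  by case/eqP: Dv; rewrite (@AD_eq s0 t) // -x0E.
apply: (minimal_left_ideal_all minL (Q := Q')) x0L.
- by exists [::]; rewrite !seval0 mul0mx.
- move=> a _ _ [t [-> tv]] [t' [-> tv']].
  exists (sscale a t ++ t'); rewrite !seval_cat !seval_scale.
  by rewrite mulmxDl -scalemxAl tv tv' scaler0 addr0.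
- move=> q _ [t [-> tv]]; exists (smul q t).
  by rewrite !seval_mul -mulmxA tv mulmx0.
- exists (x *m y); split=> //; last exact: Q'mul.
  by have [q ->] := (gen_spaceP A x).1 (subvP idL.1 x xL); rewrite idL.2.
Qed.

Variable t : 'I_(\dim L) -> sexpr k g.
Hypothesis tE : forall j, seval A (t j) = (vbasis L)`_j.
Variable E : 'I_g -> 'M[k]_(\dim L).
Hypothesis AE : forall i (j : 'I_(\dim L)), A i *m (vbasis L)`_j = \sum_l E i l j *: (vbasis L)`_l.

Let seval_vbasis f : seval A (slincomb f t) = \sum_l f l *: (vbasis L)`_l.
Proof. by rewrite seval_slincomb; apply: eq_bigr => l _; rewrite tE. Qed.

(** The columns of [B] are the images of [v] under the basis of [L]; they span a copy of [L] that
    meets the image of [M] trivially. The matrices [E] of the action on [L] do not depend on [D], so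
    different faithful modules receive the same enlarged family. *)
Lemma extend_intertwiner : (exists M', M' *m M = 1%:M) ->
  exists N : 'M[k]_(c, r + \dim L), (exists N', N' *m N = 1%:M) /\
    intertwines D (fun i => block_mx (C i) 0 0 (E i)) N.
Proof.
move=> [M' MM']; have [v genv] := generic_vector.
pose B : 'M[k]_(c, \dim L) := \matrix_(i, j) (seval D (t j) *m v) i 0.
have BE n (F : 'M[k]_(_, n)) j :
    col j (B *m F) = seval D (slincomb (fun l => F l j) t) *m v.
  rewrite seval_slincomb mulmx_suml; apply/colP=> i; rewrite summxE !mxE.
  by apply: eq_bigr => l _; rewrite -scalemxAl !mxE mulrC.
exists (row_mx M B); split.
  apply: left_inverse_cV => z; rewrite -[z]vsubmxK mul_row_col.
  set u := usubmx z; set f := dsubmx z => uf0.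
  have Bf : B *m f = M *m - u.
    by rewrite mulmxN; apply/eqP; rewrite -addr_eq0 addrC uf0.
  have f0 : f = 0.
    have : seval A (slincomb (fun l => f l 0) t) = 0.
      apply: (genv _ (- u)); first by rewrite seval_vbasis memv_suml // => l _;
        rewrite memvZ // vbasis_mem // mem_nth // size_tuple.
      by rewrite -BE Bf; apply/colP=> i; rewrite !mxE.
    rewrite seval_vbasis => fb0; apply/colP=> l; rewrite [RHS]mxE.
    by have /freeP/(_ (fun l => f l 0) fb0 l) := basis_free (vbasisP L).
  move: Bf; rewrite f0 mulmx0 => /(congr1 (mulmx M')).
  by rewrite mulmx0 mulmxA MM' mul1mx => /esym/eqP; rewrite oppr_eq0 => /eqP->; rewrite col_mx0.
move=> i; rewrite mul_mx_row mul_row_block !mulmx0 addr0 add0r DC; congr row_mx.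
apply/matrixP=> p j; transitivity (col j (B *m E i) p 0); last by rewrite mxE.
(* Both expressions have the same value at [A], hence at [D]. *)
rewrite BE -(@AD_eq (smul [:: (1, (i, [::]))] (t j))); last first.
  by rewrite seval_vbasis -AE seval_mul seval_mono tE.
rewrite seval_mul seval_mono -mulmxA !mxE; apply: eq_bigr => q _.
by rewrite mxE.
Qed.

End FaithfulModule.
End ExtendIntertwiner.

(** * A maximal common submodule is faithful *)

Section MaximalCommonSubmodule.
Variables (e : nat) (A' : 'I_g -> 'M[k]_e).
Hypothesis AA' : forall s, seval A s = 0 <-> seval A' s = 0.

(** The left inverses encode injectivity of the maps from k^r to k^d and k^e. *)
Definition common_submodule r (C : 'I_g -> 'M[k]_r) : Prop :=
  exists (M : 'M[k]_(d, r)) (N : 'M[k]_(e, r)),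
    [/\ exists M', M' *m M = 1%:M, exists N', N' *m N = 1%:M,
        intertwines A C M & intertwines A' C N].

Lemma faithful_common_submodule : exists r (C : 'I_g -> 'M[k]_r),
  common_submodule C /\ forall s, seval C s = 0 -> seval A s = 0.
Proof.
pose P n := `[< exists C : 'I_g -> 'M[k]_n, common_submodule C >].
have exP : exists n, P n.
  exists 0%N; apply/asboolP; exists (fun=> 0), 0, 0.
  by split; [exists 0; apply/matrixP=> -[]|exists 0; apply/matrixP=> -[]| |] => i;
     rewrite !mulmx0 // mul0mx.
have ubP n : P n -> (n <= d)%N.
  by move=> /asboolP[C [M [N [[M' MM'] _ _ _]]]]; exact: mulmx1_min MM'.
have [r /asboolP[C cC] maxr] := ex_maxnP exP ubP.
exists r, C; split=> // s Cs; apply/eqP/negPn/negP => As.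
have [M [N [[M' MM'] invN AM AN]]] := cC.
have annC t : seval A t *m M = 0 -> seval C t = 0.
  rewrite (intertwines_seval _ AM) => /(congr1 (mulmx M')).
  by rewrite mulmx0 mulmxA MM' mul1mx.
(* [I] is the annihilator of the image of [M] in the algebra; it is nonzero because it contains
   [seval A s]. *)
have [||I IE] := @linear_set_vspace k 'M[k]_d
    [set x | x \in gen_space A /\ x *m M = 0].
- by rewrite /= mem0v mul0mx.
- move=> a x y [xg xM] [yg yM].
  by rewrite /= memvD ?memvZ // mulmxDl -scalemxAl xM yM scaler0 addr0.
have idI : left_ideal I.
  split=> [|t x /IE[xg xM]]; first by apply/subvP => x /IE[].
  apply/IE; split; first by rewrite gen_space_mul ?mem_seval.
  by rewrite -mulmxA xM mulmx0.
have I0 : I != 0%VS.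
  apply: contraNneq As => I0; rewrite -memv0 -I0; apply/IE.
  by rewrite /= mem_seval (intertwines_seval _ AM) Cs mulmx0.
have [L minL LI] := minimal_left_ideal_exists idI I0.
have LC t : seval A t \in L -> seval C t = 0 by move=> /(subvP LI)/IE[_ /annC].
have [[Lgen Lid] L0 _] := minL.
have bL (j : 'I_(\dim L)) : (vbasis L)`_j \in L.
  by rewrite vbasis_mem // mem_nth // size_tuple.
have ext (j : 'I_(\dim L)) : exists t, (vbasis L)`_j = seval A t.
  by apply/gen_spaceP; exact: subvP (bL j).
pose t j := sval (cid (ext j)).
have tE j : seval A (t j) = (vbasis L)`_j by rewrite /t; case: (cid _).
pose E i : 'M[k]_(\dim L) := \matrix_(l, j) coord (vbasis L) l (A i *m (vbasis L)`_j).
have AE i (j : 'I_(\dim L)) : A i *m (vbasis L)`_j = \sum_l E i l j *: (vbasis L)`_l.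
  under eq_bigr do rewrite mxE.
  by apply: coord_vbasis; rewrite -[A i](seval_mono A (i, [::])) Lid.
have AAid s' : seval A s' = 0 <-> seval A s' = 0 by [].
have [M1 [invM1 AM1]] := extend_intertwiner minL LC AAid AM tE AE (ex_intro _ _ MM').
have [N1 [invN1 AN1]] := extend_intertwiner minL LC AA' AN tE AE invN.
(* Both modules now share a submodule of dimension [r + \dim L], against the maximality of [r]. *)
have : (r + \dim L <= r)%N.
  by apply: maxr; apply/asboolP; exists (fun i => block_mx (C i) 0 0 (E i)), M1, N1.
by rewrite -{2}[r]addn0 leq_add2l leqn0 dimv_eq0 (negPf L0).
Qed.

End MaximalCommonSubmodule.
End SemisimpleModules.

(** * Minimal pencils with semisimple algebras *)

Lemma semisimple_seval0 (k : fieldType) (g d e : nat)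
    (A : 'I_g -> 'M[k]_d) (A' : 'I_g -> 'M[k]_e) :
  semisimple (gen_alg A) -> free_locus A `<=` free_locus A' ->
  forall s, seval A' s = 0 -> seval A s = 0.
Proof.
move=> ssA AA' s s0; have : geval A' s \in rad (gen_alg A').
  have -> : geval A' s = 0 by apply: val_inj.
  exact: mem0v.
by move=> /(rad_transfer AA'); rewrite ssA memv0 => /eqP/(congr1 val).
Qed.

Lemma semisimple_minimal_similar (k : fieldType) (g d : nat) (A A' : 'I_g -> 'M[k]_d) :
  minimal A -> semisimple (gen_alg A) -> semisimple (gen_alg A') ->
  free_locus A = free_locus A' ->
  exists2 P : 'M[k]_d, P \in unitmx & forall i, A' i = P *m A i *m invmx P.
Proof.
move=> minA ssA ssA' AA'.
have eq0 s : seval A s = 0 <-> seval A' s = 0.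
  by split; apply: semisimple_seval0; rewrite ?AA'.
have [r [C [[M [N [[M' MM'] [N' NN'] AM AN]]] CA]]] := faithful_common_submodule ssA eq0.
have AC s : seval A s = 0 -> seval C s = 0.
  have := intertwines_seval s AM => + s0; rewrite s0 mul0mx => /esym/(congr1 (mulmx M')).
  by rewrite mulmx0 mulmxA MM' mul1mx.
(* [minimal] compares with positive sizes only; when [r = 0], faithfulness of the zero module makes
   both families vanish. *)
have [r0|r_gt0] := posnP r.
  have A0 i : A i = 0.
    rewrite -[A i](seval_mono A (i, [::])); apply: CA.
    by apply/matrixP => -[m m_lt]; exfalso; rewrite r0 in m_lt.
  exists 1%:M => [|i]; first exact: unitmx1.
  rewrite A0 mulmx0 mul0mx -[A' i](seval_mono A' (i, [::])); apply/eq0.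
  by rewrite seval_mono; exact: A0.
(* [C] and [A] satisfy the same relations, hence have the same locus, so minimality gives [d <= r];
   the embedding [M] gives the converse bound. *)
have dr : r = d.
  apply/eqP; rewrite eqn_leq (mulmx1_min MM') (minA r C r_gt0) //.
  by apply/seteqP; split; apply: locus_sub0.
case: d / dr in A A' minA ssA ssA' AA' eq0 M M' MM' N N' NN' AM AN CA AC *.
have [_ Mu] := mulmx1_unit MM'; have [_ Nu] := mulmx1_unit NN'.
have Pu : N *m invmx M \in unitmx by rewrite unitmx_mul Nu unitmx_inv.
exists (N *m invmx M) => // i.
have AE : A i = M *m C i *m invmx M by rewrite -AM mulmxK.
suff <- : A' i *m (N *m invmx M) = N *m invmx M *m A i by rewrite mulmxK.
by rewrite AE mulmxA AN -!mulmxA mulKmx.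
Qed.

Theorem theorem1 (k : fieldType) (char0 : [pchar k] =i pred0) (g d e : nat)
    (d_gt0 : (0 < d)%N) (e_gt0 : (0 < e)%N)
    (A : 'I_g -> 'M[k]_d) (A' : 'I_g -> 'M[k]_e) :
  (free_locus A `<=` free_locus A' <->
     exists phi : rad_quot (gen_alg A') -> rad_quot (gen_alg A),
       is_alg_hom phi /\
       forall i, phi (rad_class (gen A' i)) = rad_class (gen A i))
  /\
  (minimal A -> minimal A' ->
   semisimple (gen_alg A) -> semisimple (gen_alg A') ->
     (free_locus A = free_locus A' <->
        exists (de : d = e) (P : 'M[k]_e),
          P \in unitmx /\
          forall i, A' i = P *m castmx (de, de) (A i) *m invmx P)).
Proof.
split; first split.
- exact: rad_quot_hom.
(* An expression vanishing at [A'] has class zero there, so through [phi] its value at [A] has class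
   zero too, that is, lies in the radical. *)
- move=> [phi [phi_hom phi_gen]]; apply: (locus_sub (radset_nilpotent A)) => s s0.
  exists (geval A s) => //; have phiE := rad_quot_hom_geval phi_hom phi_gen.
  have -> : geval A s = geval A s - geval A [::].
    by apply: val_inj; rewrite /= seval0 subr0.
  apply/rad_classP; rewrite -!phiE; congr (phi (rad_class _)).
  by apply: val_inj; rewrite /= s0 seval0.
- move=> minA minA' ssA ssA'; split=> [AA'|[de [P [Pu PA]]]].
    have de : d = e.
      by apply/eqP; rewrite eqn_leq (minA e A') ?(minA' d A).
    case: e / de in A' e_gt0 minA' ssA' AA' *.
    have [P Pu PA] := semisimple_minimal_similar minA ssA ssA' AA'.
    by exists erefl, P; split=> // i; rewrite castmx_id.
  case: e / de in A' e_gt0 minA' ssA' P Pu PA *.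
  apply: (locus_similar Pu) => i.
  by rewrite PA castmx_id mulmxKV.
Qed.
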